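(* Let $1\le d\le n$. For each subset $P\subseteq\{2,\dots,n\}$ with $|P|=d-1$, choose (arbitrarily) a noncrossing ordered set partition $\pi^P=(\pi_1\mid\cdots\mid\pi_d)\in\mathcal{NCOP}(n,d,1)$ such that the smallest element of each block lies in $\{1\}\cup P$, and let $\mathcal{H}=\{\pi^P: P\subseteq\{2,\dots,n\},\ |P|=d-1\}$. Then $\{[\pi]_1:\pi\in\mathcal{H}\}$ is a basis of the hook Specht module $S^{(d,1^{n-d})}$.
   Context: An ordered set partition of $[n]$ with $d$ blocks is a sequence $\pi=(\pi_1\mid\cdots\mid\pi_d)$ of nonempty pairwise disjoint subsets of $[n]$ with union $[n]$; it is noncrossing if there are no $a<b<c<e$ with $a,c$ in one block and $b,e$ in a different block; $\mathcal{NCOP}(n,d,1)$ is the set of noncrossing ones. Let $M=(x_{ij})_{1\le i,j\le n}$ be an $n\times n$ matrix of distinct indeterminates; $M_I^J$ is the determinant of the submatrix with rows $I$ and columns $J$ (both increasing). For such $\pi$, a $1$-jellyfish tableau is an array $T$ with $n-d+1$ rows and $d$ columns, cells empty or containing elements of $[n]$, such that all cells in row $1$ are nonempty, each row $i>1$ has exactly one nonempty cell, and the nonempty entries of column $j$ are exactly $\pi_j$, increasing downward; $\mathcal{J}_1(\pi)$ is their set. $\mathrm{sgn}(T)=(-1)^{\mathrm{inv}(T)}$, $\mathrm{inv}(T)$ the number of inversions of the row reading word (rows left to right, top to bottom, empty cells skipped). $\mathrm{J}(T)=\prod_jM^{\pi_j}_{R_j(T)}$ with $R_j(T)$ the set of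 rows in which column $j$ is nonempty, and $[\pi]_1=\sum_{T\in\mathcal{J}_1(\pi)}\mathrm{sgn}(T)\mathrm{J}(T)$. The hook Specht module $S^{(d,1^{n-d})}$ is the $\mathbb{C}$-span in $\mathbb{C}[M]$ of all products $M^{J_0}_{\{1,\dots,n-d+1\}}\prod_{i=1}^{d-1}M^{\{j_i\}}_{\{1\}}$ over sequences $(J_0,\{j_1\},\dots,\{j_{d-1}\})$ of pairwise disjoint subsets of $[n]$ with union $[n]$ and $|J_0|=n-d+1$; it is the irreducible $\mathfrak{S}_n$-representation indexed by $(d,1^{n-d})$, with $\mathfrak{S}_n$ permuting columns of $M$. *)

(* Defs.v *)
From HB Require Import structures.
From mathcomp Require Import all_boot all_order all_algebra.
From mathcomp Require Import complex.
From mathcomp Require Import reals.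
From mathcomp Require Import mpoly.

Set Implicit Arguments.
Unset Strict Implicit.
Unset Printing Implicit Defensive.

Import Order.TTheory GRing.Theory Num.Theory.
Local Open Scope ring_scope.

(* The set [n] = {1, ..., n} is encoded as 'I_n = {0, ..., n - 1}; rows and
   columns of matrices and tableaux are likewise numbered from 0. *)

Section LinearAlgebra.
Variables (K : fieldType) (V : lmodType K) (I : finType).

(* Span, independence and bases for a family v indexed by A, so that a basis
   has pairwise distinct members. {mpoly _} is not a vectType, hence span and
   free of the library do not apply. *)
Definition family_span (A : {set I}) (v : I -> V) (x : V) : Prop :=
  exists c : I -> K, x = \sum_(i in A) c i *: v i.

Definition family_free (A : {set I}) (v : I -> V) : Prop :=
  forall c : I -> K, \sum_(i in A) c i *: v i = 0 ->
  forall i, i \in A -> c i = 0.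

Definition family_basis (A : {set I}) (v : I -> V) (W : V -> Prop) : Prop :=
  family_free A v /\ (forall x, W x <-> family_span A v x).

End LinearAlgebra.

Section OrderedSetPartitions.
Variables n d : nat.

Definition blocks := {ffun 'I_d -> {set 'I_n}}.

Definition ordered_set_partition (p : blocks) : Prop :=
  [/\ forall j, p j != set0,
      forall j k, j != k -> [disjoint p j & p k]
    & \bigcup_j p j = [set: 'I_n]].

Definition noncrossing (p : blocks) : Prop :=
  ~ exists (a b c e : 'I_n) (j k : 'I_d),
      [/\ (a < b)%N, (b < c)%N, (c < e)%N & j != k]
      /\ [/\ a \in p j, c \in p j, b \in p k & e \in p k].

Definition NCOP1 (p : blocks) : Prop :=
  ordered_set_partition p /\ noncrossing p.

Definition is_smallest (x : 'I_n) (B : {set 'I_n}) : Prop :=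
  x \in B /\ (forall y, y \in B -> (x <= y)%N).

Definition minima_in_1U (P : {set 'I_n}) (p : blocks) : Prop :=
  forall (j : 'I_d) (x : 'I_n),
    is_smallest x (p j) -> (x : nat) = 0%N \/ x \in P.

Definition hook_subsets : {set {set 'I_n}} :=
  [set P : {set 'I_n} |
    (P \subset [set x : 'I_n | (0 < x)%N]) && (#|P| == (d - 1)%N)].

End OrderedSetPartitions.

Section Tableaux.
Variables n d : nat.

Definition tableau := 'M[option 'I_n]_((n - d).+1, d).

Definition is_jellyfish (p : blocks n d) (T : tableau) : bool :=
  [&& [forall j, T ord0 j != None],
      [forall i : 'I_(n - d).+1, (0 < i)%N ==>
         (#|[set j | T i j != None]| == 1%N)],
      [forall j, [set x | [exists i, T i j == Some x]] == p j]
    & [forall j, forall i : 'I_(n - d).+1, forall i' : 'I_(n - d).+1,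
       forall x : 'I_n, forall y : 'I_n,
         [&& (i < i')%N, T i j == Some x & T i' j == Some y] ==> (x < y)%N]].

Definition jellyfish_tableaux (p : blocks n d) : {set tableau} :=
  [set T | is_jellyfish p T].

Definition reading_word (T : tableau) : seq nat :=
  map (@nat_of_ord n)
    (pmap id [seq T i j | i <- enum 'I_(n - d).+1, j <- enum 'I_d]).

Definition inversions (w : seq nat) : nat :=
  #|[set ab : 'I_(size w) * 'I_(size w) |
      (ab.1 < ab.2)%N && (nth 0%N w ab.2 < nth 0%N w ab.1)%N]|.

Definition inv (T : tableau) : nat := inversions (reading_word T).

(* The rows of T are the first n - d + 1 rows of the n x n matrix M. *)
Definition nonempty_rows (T : tableau) (j : 'I_d) : {set 'I_n} :=
  [set k : 'I_n | [exists i : 'I_(n - d).+1,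
     ((i : nat) == (k : nat)) && (T i j != None)]].

End Tableaux.

Section Polynomials.
Variables (K : fieldType) (n : nat).

Definition gen_mx : 'M[{mpoly K[n * n]}]_n :=
  \matrix_(i, j) 'X_(mxvec_index i j).

(* M_I^J, meaningful when #|I| = #|J|: the sequences enum I and enum J are
   increasing, and enum_val b is only the default value of nth. *)
Definition minor (I J : {set 'I_n}) : {mpoly K[n * n]} :=
  \det (\matrix_(a < #|I|, b < #|I|)
          gen_mx (enum_val a) (nth (enum_val b) (enum J) b)).

Definition first_rows (k : nat) : {set 'I_n} := [set i : 'I_n | (i < k)%N].

Variable d : nat.

Definition jellyfish_monomial (p : blocks n d) (T : tableau n d) :
    {mpoly K[n * n]} :=
  \prod_(j < d) minor (nonempty_rows T j) (p j).

Definition jellyfish_invariant (p : blocks n d) : {mpoly K[n * n]} :=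
  \sum_(T in jellyfish_tableaux p) (-1) ^+ inv T * jellyfish_monomial p T.

(* Sequences (J_0, {j_1}, ..., {j_(d-1)}), encoded as (J_0, (j_1, ...)). *)
Definition hook_index : finType :=
  ({set 'I_n} * {ffun 'I_(d - 1) -> 'I_n})%type.

Definition hook_sequences : {set hook_index} :=
  [set s : hook_index |
    [&& #|s.1| == (n - d + 1)%N,
        [forall i, s.2 i \notin s.1],
        [forall i, forall i', (i != i') ==> (s.2 i != s.2 i')]
      & s.1 :|: [set s.2 i | i : 'I_(d - 1)] == [set: 'I_n]]].

Definition hook_generator (s : hook_index) : {mpoly K[n * n]} :=
  minor (first_rows (n - d + 1)) s.1
  * \prod_(i < d - 1) minor (first_rows 1) [set s.2 i].

Definition hook_specht : {mpoly K[n * n]} -> Prop :=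
  family_span hook_sequences hook_generator.

End Polynomials.

(* Main.v *)
(* The invariant [pi]_1 is a single determinant: row p of its n x n matrix is
   the first row of M with the entries outside the block pi_p erased, for the d
   blocks, and the other n - d rows are rows 2, ..., n - d + 1 of M. Grouping
   its Leibniz expansion according to the blocks hit by the rows gives back the
   sum over tableaux. The generators of the hook module are, up to sign, such
   determinants for partitions with at most one block that is not a singleton.
   Let E_Q, for Q in {2, ..., n} with |Q| = d - 1, be the generator with
   J_0 = [n] \ Q. Replacing the row of the block containing 1 by the sum of
   the d block rows, and expanding the others, writes every such determinant in
   terms of the E_Q.
   Evaluating at a matrix whose first row is the indicator of {1} u Q and whose
   other rows are the unit vectors of the complement keeps exactly the
   partitions that have {1} u Q as a transversal. For a partition with minima
   {1} u P this forces Q = P or sum Q > sum P, since a transversal dominates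
   the minima block by block. By triangularity the family is free; it has as
   many members as there are E_Q, hence also spans. *)

Require Import Defs.
From HB Require Import structures.
From mathcomp Require Import all_boot all_order all_algebra.
From mathcomp Require Import perm.
From mathcomp Require Import complex.
From mathcomp Require Import reals.
From mathcomp Require Import mpoly.
From mathcomp Require Import zify.

Set Implicit Arguments.
Unset Strict Implicit.
Unset Printing Implicit Defensive.

Import Order.TTheory GRing.Theory Num.Theory.
Local Open Scope ring_scope.

(** * Determinants *)

Section Determinants.
Variable S : comNzRingType.

(** The Weinstein-Aronszajn identity. Multiplying [B] by the unipotent [T] on the left or on the
    right gives a block lower triangular matrix whose determinant is one of the two sides. *)
Lemma det_1_add_mulmx m n (U : 'M[S]_(m, n)) (V : 'M[S]_(n, m)) :
  \det (1%:M + U *m V) = \det (1%:M + V *m U).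
Proof.
pose B := block_mx 1%:M (- U) V 1%:M.
pose T := block_mx 1%:M U (0 : 'M_(n, m)) 1%:M.
have detT : \det T = 1 by rewrite det_ublock !det1 mulr1.
have <- : \det (T *m B) = \det (1%:M + U *m V).
  rewrite mulmx_block !mul1mx !mul0mx !mulmx1 !add0r addNr.
  by rewrite det_lblock det1 mulr1.
have <- : \det (B *m T) = \det (1%:M + V *m U).
  rewrite mulmx_block !mul1mx !mulmx1 !mulmx0 !addr0 subrr.
  by rewrite det_lblock det1 mul1r [V *m U + _]addrC.
by rewrite !det_mulmx mulrC.
Qed.

(** The rows of [A - 1] outside [D] vanish, so it factors through the matrix [E] that selects the
    rows in [D]; exchanging the two factors leaves a determinant of size [#|D|]. *)
Lemma det_supported n (A : 'M[S]_n) (D : {set 'I_n}) :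
  (forall i j, (i \notin D) || (j \notin D) -> A i j = (i == j)%:R) ->
  \det A = \det (\matrix_(u < #|D|, v < #|D|) A (enum_val u) (enum_val v)).
Proof.
move=> hA.
pose E : 'M[S]_(#|D|, n) := \matrix_(u, i) (enum_val u == i)%:R.
pose X := A - 1%:M.
have EX w k : (E *m X) w k = X (enum_val w) k.
  rewrite mxE (bigD1 (enum_val w))//= big1 => [|l ne].
    by rewrite mxE eqxx mul1r addr0.
  by rewrite mxE eq_sym (negPf ne) mul0r.
have hX : X = E^T *m (E *m X).
  apply/matrixP => i j; rewrite [RHS]mxE.
  under eq_bigr => u _ do rewrite EX 2!mxE.
  case: (boolP (i \in D)) => iD; last first.
    rewrite big1 => [|u _]; last first.
      case: eqP => [e|_]; rewrite ?mul0r//.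
      by rewrite -e enum_valP in iD.
    by rewrite !mxE hA ?iD// subrr.
  rewrite (bigD1 (enum_rank_in iD i))//= big1 => [|u ne]; last first.
    rewrite (_ : enum_val u == i = false) ?mul0r//.
    apply: contraNF ne => /eqP e; apply/eqP/enum_val_inj.
    by rewrite enum_rankK_in.
  by rewrite enum_rankK_in// eqxx mul1r addr0.
have -> : A = 1%:M + E^T *m (E *m X) by rewrite -hX addrC subrK.
rewrite det_1_add_mulmx; congr (\det _); apply/matrixP => u v.
rewrite -hX [LHS]mxE [X in _ + X]mxE (bigD1 (enum_val v))//=.
rewrite big1 => [|l ne]; last first.
  by rewrite !mxE eq_sym (negPf ne) mulr0.
by rewrite EX !mxE eqxx mulr1 addr0 (inj_eq enum_val_inj) addrC subrK.
Qed.

(** Instead of sorting the indices by colour, [A] is written as the product over the colours [k] of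
    matrices equal to [A] on the rows of colour [k] and to the identity on the others. *)
Lemma det_coloured n (I : finType) (c : 'I_n -> I) (A : 'M[S]_n) :
  (forall i j, c i != c j -> A i j = 0) ->
  \det A = \prod_k \det (\matrix_(u < #|[set i | c i == k]|,
                                  v < #|[set i | c i == k]|)
                           A (enum_val u) (enum_val v)).
Proof.
move=> hA.
pose B (P : pred I) : 'M[S]_n :=
  \matrix_(i, j) if P (c i) then A i j else (i == j)%:R.
have BT : A = B predT by apply/matrixP => i j; rewrite mxE.
have hB (s : seq I) : uniq s ->
    \det (B (mem s)) = \prod_(k <- s) \det (B (pred1 k)).
  elim: s => [_|k s IH] /=.
    rewrite big_nil (_ : B _ = 1%:M) ?det1//.
    by apply/matrixP => i j; rewrite !mxE.
  case/andP => ks us; rewrite big_cons -(IH us) -det_mulmx.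
  congr (\det _); apply/matrixP => i j; rewrite !mxE /= inE.
  case: eqP => [e|ne] /=.
    rewrite [RHS](bigD1 j)//= big1 => [|l nl].
      rewrite !mxE /= e eqxx addr0.
      have [ej|nj] := eqVneq (c j) k.
        by rewrite /= ej (negPf ks) eqxx mulr1.
      by rewrite hA ?mul0r// e eq_sym.
    rewrite !mxE /= e eqxx.
    have [el|nl'] := eqVneq (c l) k.
      by rewrite el (negPf ks) (negPf nl) mulr0.
    by rewrite hA ?mul0r// e eq_sym.
  rewrite [RHS](bigD1 i)//= big1 => [|l nl].
    by rewrite !mxE /= (introF eqP ne) eqxx mul1r addr0.
  by rewrite !mxE /= (introF eqP ne) eq_sym (negPf nl) mul0r.
rewrite {1}BT (_ : B predT = B (mem (index_enum I))); last first.
  by apply/matrixP => i j; rewrite !mxE /= mem_index_enum.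
rewrite hB ?index_enum_uniq//; apply: eq_bigr => k _.
rewrite (@det_supported _ _ [set i | c i == k]).
  congr (\det _); apply/matrixP => u v; rewrite !mxE /=.
  by have := enum_valP u; rewrite inE => ->.
move=> i j; rewrite !inE mxE /=; have [e|//] := eqVneq (c i) k => /= ne.
rewrite hA; last by rewrite e eq_sym.
by case: eqP => // eij; rewrite -eij e eqxx in ne.
Qed.

(** The row operation is multiplication by [1 + u v], whose determinant is [1 + v u = 1] because
    [i0] lies outside [D]. *)
Lemma det_add_rows n (i0 : 'I_n) (D : {pred 'I_n}) (A B : 'M[S]_n) :
  i0 \notin D ->
  (forall i j, i != i0 -> B i j = A i j) ->
  (forall j, B i0 j = A i0 j + \sum_(i in D) A i j) ->
  \det B = \det A.
Proof.
move=> i0D hB hB0.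
pose u : 'cV[S]_n := \col_i (i == i0)%:R.
pose v : 'rV[S]_n := \row_j (j \in D)%:R.
have -> : B = (1%:M + u *m v) *m A.
  apply/matrixP => i j; rewrite mulmxDl mul1mx -mulmxA [RHS]mxE.
  rewrite [X in _ + X]mxE big_ord1 !mxE.
  have [->|ne] := eqVneq i i0; last by rewrite mul0r addr0 hB.
  rewrite mul1r hB0; congr (_ + _); rewrite [LHS]big_mkcond /=.
  by apply: eq_bigr => k _; rewrite mxE; case: ifP; rewrite ?mul1r ?mul0r.
rewrite det_mulmx det_1_add_mulmx [X in \det X]mx11_scalar det_scalar1 !mxE.
rewrite big1 ?addr0 ?mul1r// => k _; rewrite !mxE.
by case: eqP => [->|]; rewrite ?mulr0// (negPf i0D) mul0r.
Qed.

(** * Matrices with erased entries *)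

Definition masked n (X : 'M[S]_n) (m : rel 'I_n) : 'M[S]_n :=
  \matrix_(i, j) if m i j then X i j else 0.

Definition compatible n (m : rel 'I_n) (w : 'S_n) := [forall i, m i (w i)].

Definition leibniz_term n (X : 'M[S]_n) (w : 'S_n) : S :=
  (-1) ^+ w * \prod_i X i (w i).

(** The mask enters only through its compatible permutations, so masks with the same ones can be
    exchanged under the determinant. *)
Lemma det_masked n (X : 'M[S]_n) (m : rel 'I_n) :
  \det (masked X m) = \sum_(w | compatible m w) leibniz_term X w.
Proof.
rewrite /determinant [RHS]big_mkcond /=; apply: eq_bigr => w _.
case: ifP => [/forallP h|/negbT].
  by congr (_ * _); apply: eq_bigr => i _; rewrite mxE h.
rewrite negb_forall => /existsP [i hi].
by rewrite (bigD1 i)//= mxE (negPf hi) mul0r mulr0.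
Qed.

End Determinants.

(** In the Vandermonde determinant of 0, ..., n - 1, permuting the columns by [w] contributes the
    sign of [w]; in the product formula it makes one factor negative for each inversion. Comparing
    signs over the integers gives the claim. *)
Lemma sign_inversions n (w : 'S_n) (R : pzRingType) :
  (-1) ^+ #|[set ab : 'I_n * 'I_n | (ab.1 < ab.2)%N && (w ab.2 < w ab.1)%N]|
  = (-1) ^+ (w : bool) :> R.
Proof.
suff h : (-1) ^+ #|[set ab : 'I_n * 'I_n |
              (ab.1 < ab.2)%N && (w ab.2 < w ab.1)%N]| = (-1) ^+ w :> int.
  by have /(congr1 (fun z : int => z%:~R : R)) := h; rewrite !rmorph_sign.
pose a : 'rV[int]_n := \row_j (j : nat)%:Z.
have hsg (x y : nat) : Num.sg (x%:Z - y%:Z) =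
    if x == y then 0 else (-1) ^+ (x < y)%N.
  case: ltngtP => h; rewrite ?h ?subrr ?sgr0//.
    by rewrite ltr0_sg// subr_lt0 ltz_nat.
  by rewrite gtr0_sg// subr_gt0 ltz_nat.
have sgprod (I : finType) (P : pred I) (F : I -> int) :
    Num.sg (\prod_(i | P i) F i) = \prod_(i | P i) Num.sg (F i).
  by apply: (big_morph Num.sg (@sgrM _)); rewrite sgr1.
have := congr1 Num.sg (det_Vandermonde (col_perm w a)).
have -> : Vandermonde n (col_perm w a) = col_perm w (Vandermonde n a).
  by apply/matrixP => i j; rewrite !mxE.
rewrite col_permE det_mulmx det_perm odd_permV sgrM det_Vandermonde.
rewrite !sgprod (eq_bigr (fun=> 1)) => [|i _]; last first.
  rewrite sgprod big1// => j ij; rewrite !mxE hsg.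
  by rewrite gtn_eqF//= ltnNge ltnW.
rewrite big1// mul1r => h.
have {h} : (-1) ^+ w = \prod_(i < n) \prod_(j < n | (i < j)%N)
      (-1) ^+ (w j < w i)%N :> int.
  rewrite -[LHS](_ : Num.sg ((-1) ^+ w) = _).
    rewrite h; apply: eq_bigr => i _; rewrite sgprod; apply: eq_bigr => j ij.
    rewrite !mxE hsg; case: eqP => // /val_inj /perm_inj e.
    by rewrite e ltnn in ij.
  by case: (odd_perm w); rewrite ?expr1 ?expr0 ?sgrN1 ?sgr1.
move=> ->; rewrite pair_big_dep /= -prodr_const big_mkcond /=.
rewrite [RHS]big_mkcond /=; apply: eq_bigr => -[i j] _ /=; rewrite inE /=.
by case: (ltnP i j); case: (ltnP (w j) (w i)).
Qed.

(** * Permutations monotone on the fibres of a colouring *)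

Section MonotoneColourings.

Lemma sorted_enum_ord n (A : {set 'I_n}) :
  sorted [rel x y : 'I_n | (x < y)%N] (enum A).
Proof.
rewrite /enum_mem; apply: sorted_filter => [y x z|]; first exact: ltn_trans.
have := iota_ltn_sorted 0 n; rewrite -(val_enum_ord n) sorted_map.
by rewrite enumT.
Qed.

Lemma enum_imset_mono m n (f : 'I_m -> 'I_n) (A : {set 'I_m}) :
  {in A &, forall x y : 'I_m, (x < y)%N -> (f x < f y)%N} ->
  enum (f @: A) = map f (enum A).
Proof.
move=> hf.
apply: (@irr_sorted_eq _ [rel x y : 'I_n | (x < y)%N]).
- by move=> y x z; apply: ltn_trans.
- by move=> x /=; rewrite ltnn.
- exact: sorted_enum_ord.
- rewrite sorted_map.
  apply: (sub_in_sorted (P := mem A)) (sorted_enum_ord A) => //.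
  by apply/allP => x; rewrite mem_enum.
move=> y; rewrite mem_enum; apply/imsetP/mapP => -[x xA ->]; exists x => //.
  by rewrite mem_enum.
by rewrite -mem_enum.
Qed.

(** The k-th element of each colour under [c] is sent to the k-th element of that colour under
    [c']. *)
Lemma exists_monotone n (T : eqType) (c c' : 'I_n -> T) :
  (forall t, #|[set i | c i == t]| = #|[set i | c' i == t]|) ->
  exists w : 'S_n, (forall i, c' (w i) = c i) /\
    (forall i j : 'I_n, (i < j)%N -> c i = c j -> (w i < w j)%N).
Proof.
move=> hc.
pose C t := enum [set i | c i == t]; pose C' t := enum [set i | c' i == t].
have sz t : size (C t) = size (C' t) by rewrite -!cardE hc.
have memC i : i \in C (c i) by rewrite mem_enum inE.
have ind i : (index i (C (c i)) < size (C' (c i)))%N.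
  by rewrite -sz index_mem.
pose f i := nth i (C' (c i)) (index i (C (c i))).
have cf i : c' (f i) = c i.
  by have := mem_nth i (ind i); rewrite mem_enum inE => /eqP.
have f_inj : injective f.
  move=> i j e; have cij : c i = c j by rewrite -!cf e.
  move: e (ind i) (ind j) (memC i) (memC j); rewrite /f cij => e hi hj mi mj.
  move/eqP: e; rewrite (set_nth_default j i)// nth_uniq ?enum_uniq// => /eqP e.
  exact: (index_inj i mi mj e).
exists (perm f_inj); split=> [i|i j ij cij]; first by rewrite permE.
rewrite !permE /f; move: (ind i) (ind j) (memC i) (memC j); rewrite cij.
move=> hi hj mi mj; rewrite (set_nth_default j i)//.
apply: (sorted_ltn_nth (leT := [rel x y : 'I_n | (x < y)%N])) => //.
- by move=> y x z; apply: ltn_trans.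
- exact: sorted_enum_ord.
case: ltngtP => // [h|h].
  have tr : transitive [rel x y : 'I_n | (x < y)%N].
    by move=> y x z; apply: ltn_trans.
  have /= := sorted_ltn_index tr (sorted_enum_ord _) _ _ mj mi h.
  by rewrite ltnNge ltnW.
by rewrite (index_inj i mi mj h) ltnn in ij.
Qed.

Lemma exists_perm_mem n (B Q : {set 'I_n}) : #|B| = #|Q| ->
  exists w : 'S_n, forall p, (w p \in Q) = (p \in B).
Proof.
move=> e.
have [|w [hw _]] := @exists_monotone n bool (mem B) (mem Q); last by exists w.
have cfib (A : {set 'I_n}) (t : bool) :
    #|[set p | (p \in A) == t]| = if t then #|A| else (n - #|A|)%N.
  case: t; first by apply: eq_card => x; rewrite !inE eqb_id.
  have -> : [set p | (p \in A) == false] = ~: A.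
    by apply/setP => x; rewrite !inE eqbF_neg.
  by rewrite cardsCs setCK card_ord.
by move=> t; rewrite !cfib e.
Qed.

Variables (n : nat) (T : eqType) (c : 'I_n -> T).

(** With [w] read as a word, letters of equal colour appear in increasing order. For reading words
    of tableaux this says that the columns increase downward. *)
Definition fibre_monotone (w : 'S_n) : bool :=
  [forall i : 'I_n, forall j : 'I_n,
     (i < j)%N && (c (w i) == c (w j)) ==> (w i < w j)%N].

Lemma fibre_monotoneP (w : 'S_n) :
  reflect (forall i j : 'I_n, (i < j)%N -> c (w i) = c (w j) -> (w i < w j)%N)
          (fibre_monotone w).
Proof.
apply: (iffP forallP) => [h i j ij e|h i].
  by have /forallP/(_ j) := h i; rewrite ij e eqxx.
by apply/forallP => j; apply/implyP => /andP [ij /eqP e]; apply: h.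
Qed.

Lemma exists_standardisation (w' : 'S_n) :
  exists w : 'S_n, (forall i, c (w i) = c (w' i)) /\ fibre_monotone w.
Proof.
have [t|w [h1 h2]] := @exists_monotone n T (fun i => c (w' i)) c.
  have -> : [set i | c (w' i) == t] = w' @^-1: [set i | c i == t].
    by apply/setP => i; rewrite !inE.
  by rewrite card_preimset//; apply: perm_inj.
exists w; split=> //; apply/fibre_monotoneP => i j ij e.
by apply: h2 => //; rewrite -!h1.
Qed.

(** Both permutations map the same set of positions onto a given colour class, and an increasing
    bijection between two finite sets of ordinals is unique. *)
Lemma fibre_monotone_inj (w1 w2 : 'S_n) :
  fibre_monotone w1 -> fibre_monotone w2 ->
  (forall i, c (w1 i) = c (w2 i)) -> w1 = w2.
Proof.
move=> /fibre_monotoneP h1 /fibre_monotoneP h2 e.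
apply/permP => i; pose A := [set k | c (w1 k) == c (w1 i)].
have imA (w : 'S_n) : (forall k, c (w k) = c (w1 k)) ->
    w @: A = [set x | c x == c (w1 i)].
  move=> hw; apply/setP => x; apply/imsetP/idP.
    by case=> k; rewrite !inE => hk ->; rewrite hw.
  rewrite inE => hx; exists ((w^-1)%g x); rewrite ?permKV//.
  by rewrite inE -hw permKV.
have /esym := etrans (imA w1 (fun=> erefl)) (esym (imA w2 (fun k => esym (e
  k)))).
move/(congr1 (fun B : {set 'I_n} => enum B)).
rewrite !enum_imset_mono => [|x y|x y].
- by move/eq_in_map => /(_ i); rewrite mem_enum inE eqxx => ->.
- by rewrite !inE => /eqP hx /eqP hy xy; apply: h1; rewrite ?hx ?hy.
- by rewrite !inE => /eqP hx /eqP hy xy; apply: h2; rewrite -?e ?hx ?hy.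
Qed.

End MonotoneColourings.

(** * Spans and bases of families *)

Section FamilySpan.
Variables (K : fieldType) (V : lmodType K) (I : finType).
Variables (A : {set I}) (v : I -> V).

Lemma family_span0 : family_span A v 0.
Proof. by exists (fun=> 0); rewrite big1// => i _; rewrite scale0r. Qed.

Lemma family_spanZ a x : family_span A v x -> family_span A v (a *: x).
Proof.
case=> c ->; exists (fun i => a * c i); rewrite scaler_sumr.
by apply: eq_bigr => i _; rewrite scalerA.
Qed.

Lemma family_span_sum (J : Type) (r : seq J) (P : pred J) (F : J -> V) :
  (forall j, P j -> family_span A v (F j)) ->
  family_span A v (\sum_(j <- r | P j) F j).
Proof.
move=> hF; apply: big_ind => // [|x y [c ->] [c' ->]].
  exact: family_span0.
exists (fun i => c i + c' i); rewrite -big_split.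
by apply: eq_bigr => i _; rewrite scalerDl.
Qed.

Lemma family_span_mem i : i \in A -> family_span A v (v i).
Proof.
move=> iA; exists (fun j => (j == i)%:R); rewrite (bigD1 i)//= eqxx scale1r.
rewrite big1 ?addr0// => j /andP [_ /negPf ->]; exact: scale0r.
Qed.

Lemma family_span_trans (J : finType) (B : {set J}) (u : J -> V) x :
  (forall j, j \in B -> family_span A v (u j)) ->
  family_span B u x -> family_span A v x.
Proof.
by move=> h [c ->]; apply: family_span_sum => j jB; apply/family_spanZ/h.
Qed.

End FamilySpan.

(* The transition matrix from v to u is square, and invertible as u is free. *)
Lemma family_free_span (K : fieldType) (V : lmodType K) (I : finType)
    (A : {set I}) (u v : I -> V) :
  family_free A u -> (forall i, i \in A -> family_span A v (u i)) ->
  forall i, i \in A -> family_span A u (v i).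
Proof.
move=> fu hu i iA.
have /fin_all_exists [c hc] : forall a : 'I_#|A|, exists c : I -> K,
    u (enum_val a) = \sum_(j in A) c j *: v j.
  by move=> a; apply/hu/enum_valP.
pose C := \matrix_(a < #|A|, b < #|A|) c a (enum_val b).
have uC a : u (enum_val a) = \sum_b C a b *: v (enum_val b).
  by rewrite hc big_enum_val; apply: eq_bigr => b _; rewrite mxE.
have C_unit : C \in unitmx.
  rewrite -row_free_unit; apply: inj_row_free => x xC.
  (* Freeness concerns coefficients indexed by [I], so the row vector [x] is reindexed, with value 0
     outside [A]. *)
  pose x' j := if [pick a | enum_val a == j :> I] is Some a then x 0 a else 0.
  have x'E a : x' (enum_val a) = x 0 a.
    rewrite /x'; case: pickP => [b /eqP /enum_val_inj -> //|/(_ a)].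
    by rewrite eqxx.
  have x'0 : \sum_(j in A) x' j *: u j = 0.
    rewrite big_enum_val (eq_bigr (fun a => \sum_b (x 0 a * C a b) *: v
      (enum_val b))).
      rewrite exchange_big big1//= => b _.
      by have /matrixP/(_ 0 b) := xC; rewrite !mxE -scaler_suml => ->;
        rewrite scale0r.
    by move=> a _; rewrite x'E uC scaler_sumr; apply: eq_bigr => b _;
      rewrite scalerA.
  by apply/rowP => a; rewrite mxE -x'E (fu _ x'0)// enum_valP.
rewrite -(enum_rankK_in iA iA); set a := enum_rank_in iA i.
have -> : v (enum_val a) = \sum_b (invmx C a b) *: u (enum_val b).
  have h k : \sum_b (invmx C a b * C b k) *: v (enum_val k)
             = (a == k)%:R *: v (enum_val k).
    rewrite -scaler_suml; congr (_ *: _).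
    by have /matrixP/(_ a k) := mulVmx C_unit; rewrite !mxE.
  under eq_bigr => b _ do rewrite uC scaler_sumr.
  rewrite exchange_big (eq_bigr (fun k => (a == k)%:R *: v (enum_val k))).
    rewrite (bigD1 a)//= big1 => [|k ne]; first by rewrite eqxx scale1r addr0.
    by rewrite eq_sym (negPf ne) scale0r.
  by move=> k _; rewrite -h; apply: eq_bigr => b _; rewrite scalerA.
apply: family_span_sum => b _; apply: family_spanZ.
exact/family_span_mem/enum_valP.
Qed.


(** Induction on the rank: [phi i] applied to a relation leaves the term of [i] and terms of smaller
    rank, whose coefficients already vanish. *)
Lemma family_free_triangular (K : fieldType) (V : lmodType K) (I : finType)
    (A : {set I}) (u : I -> V) (rank : I -> nat) (phi : I -> {scalar V}) :
  (forall i, i \in A -> phi i (u i) != 0) ->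
  (forall i j, i \in A -> j \in A -> phi i (u j) != 0 ->
     i = j \/ (rank j < rank i)%N) ->
  family_free A u.
Proof.
move=> hd ht c c0 i; have [m] := ubnP (rank i); elim: m i => // m IH i rm iA.
have /eqP : phi i (\sum_(j in A) c j *: u j) = 0 by rewrite c0 linear0.
rewrite linear_sum (bigD1 i)//= big1 => [|j /andP [jA ji]].
  by rewrite addr0 linearZ /= mulf_eq0 (negPf (hd i iA)) orbF => /eqP.
rewrite linearZ /=; have [->|nz] := eqVneq (phi i (u j)) 0; first exact: mulr0.
have [e|rj] := ht i j iA jA nz; first by rewrite e eqxx in ji.
by rewrite (IH j) ?mul0r//; apply: leq_trans rj _; rewrite -ltnS.
Qed.

(** Passes from the family indexed by the subsets [P] to the one indexed by the chosen partitions
    themselves. *)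
Lemma family_basis_imset (K : fieldType) (V : lmodType K) (I J : finType)
    (A : {set I}) (f : I -> J) (v : J -> V) (W : V -> Prop) :
  {in A &, injective f} -> family_basis A (v \o f) W ->
  family_basis [set f i | i in A] v W.
Proof.
move=> f_inj [hfree hspan]; split=> [c|x].
  rewrite big_imset//= => /(hfree (c \o f)) h j /imsetP [i iA ->]; exact: h.
split=> [/hspan|[c ->]].
  by apply: family_span_trans => i iA; apply/family_span_mem/imset_f.
by apply/hspan; exists (c \o f); rewrite big_imset.
Qed.

(** * The determinant of a partition *)

Section Hook.
Variables (K : fieldType) (n d : nat).
Hypotheses (hd : (0 < d)%N) (hdn : (d <= n)%N).

Lemma minorE (I J : {set 'I_n}) m (x0 : 'I_n) : #|I| = m -> #|J| = m ->
  minor K I J = \det (\matrix_(a < m, b < m)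
                gen_mx K n (nth x0 (enum I) a) (nth x0 (enum J) b)).
Proof.
move=> <- eJ; congr (\det _); apply/matrixP => a b; rewrite [LHS]mxE [RHS]mxE.
rewrite (enum_val_nth x0); congr (gen_mx _ _ _ _).
by apply: set_nth_default; rewrite -cardE eJ.
Qed.

(* Position p of the reading word of a tableau lies in row 0 if p < d, and in
   row p - d + 1 otherwise. *)
Definition row_of (p : 'I_n) : 'I_n := insubd p (p.+1 - d)%N.

Lemma val_row_of (p : 'I_n) : row_of p = (p.+1 - d)%N :> nat.
Proof. by rewrite /row_of val_insubd ifT//; have := ltn_ord p; lia. Qed.

(** [d] copies of the first row of the generic matrix, followed by its next [n - d] rows. *)
Definition hook_mx : 'M[{mpoly K[n * n]}]_n :=
  \matrix_(p, a) gen_mx K n (row_of p) a.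

Definition block_mask (c : 'I_n -> 'I_d) : rel 'I_n :=
  fun p a => (p < d)%N ==> (c a == p :> nat).

Lemma compatible_blockP (c : 'I_n -> 'I_d) (w : 'S_n) :
  reflect (forall p : 'I_n, (p < d)%N -> c (w p) = p :> nat)
          (compatible (block_mask c) w).
Proof.
apply: (iffP forallP) => h p; first by move=> pd;
  move: (h p) => /implyP/(_ pd)/eqP.
by apply/implyP => pd; apply/eqP/h.
Qed.

(** [row_of] fails to increase strictly only among positions below [d], and there compatibility
    gives distinct positions distinct colours. *)
Lemma row_of_mono (c : 'I_n -> 'I_d) (w : 'S_n) (p q : 'I_n) :
  compatible (block_mask c) w -> c (w p) = c (w q) -> (p < q)%N ->
  (row_of p < row_of q)%N.
Proof.
move=> /compatible_blockP hw e pq; rewrite !val_row_of.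
have [qd|] := ltnP q d; last lia.
by have := hw p; rewrite e hw//; lia.
Qed.

(** The monomial of the tableau with reading word [w]: position [p] belongs to column [c (w p)]. *)
Definition minor_product (c : 'I_n -> 'I_d) (w : 'S_n) : {mpoly K[n * n]} :=
  \prod_j minor K (row_of @: [set p | c (w p) == j]) [set a | c a == j].

(** Permuting the columns by [w] makes the matrix block diagonal for the colouring [c (w p)] of
    positions. Both [row_of] and [w] increase on each colour class, so the diagonal blocks are
    exactly the minors. *)
Lemma det_fibres (c : 'I_n -> 'I_d) (w : 'S_n) :
  compatible (block_mask c) w -> fibre_monotone c w ->
  \det (masked hook_mx (fun p a => c a == c (w p)))
  = (-1) ^+ w * minor_product c w.
Proof.
move=> hw /fibre_monotoneP hm.
set A := masked _ _.
have -> : \det A = (-1) ^+ w * \det (col_perm w A).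
  by rewrite col_permE det_mulmx det_perm odd_permV mulrCA -signr_addb addbb
    mulr1.
congr (_ * _); rewrite (det_coloured (c := fun p => c (w p))); last first.
  by move=> i j ne; rewrite !mxE eq_sym (negPf ne).
apply: eq_bigr => j _; set C := [set p | _].
have hrow : {in C &, forall x y : 'I_n, (x < y)%N -> (row_of x < row_of y)%N}.
  by move=> x y; rewrite !inE => /eqP ex /eqP ey; apply: (row_of_mono hw);
    rewrite ex ey.
have hwC : {in C &, forall x y : 'I_n, (x < y)%N -> (w x < w y)%N}.
  by move=> x y; rewrite !inE => /eqP ex /eqP ey xy; apply: hm; rewrite ?ex ?ey.
have imw : [set a | c a == j] = w @: C.
  apply/setP => a; rewrite inE; apply/idP/imsetP => [h|[p]].
    by exists ((w^-1)%g a); rewrite ?inE permKV.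
  by rewrite inE => h ->.
have x0 : 'I_n := Ordinal (leq_trans hd hdn).
rewrite imw (@minorE _ _ #|C| x0); first last.
- by rewrite card_imset//; apply: perm_inj.
- have /(congr1 size) := enum_imset_mono hrow.
  by rewrite size_map -!cardE.
congr (\det _); apply/matrixP => u v; rewrite !mxE.
rewrite !enum_imset_mono// !(nth_map x0) -?cardE// -!enum_val_nth.
have := enum_valP u; have := enum_valP v; rewrite !inE => /eqP -> /eqP ->.
by rewrite eqxx.
Qed.

(** The Leibniz terms are grouped by standardisation. The permutations with the colour pattern of
    [w] are the compatible ones of the mask in [det_fibres]. *)
Lemma det_block_mask (c : 'I_n -> 'I_d) :
  \det (masked hook_mx (block_mask c))
  = \sum_(w | compatible (block_mask c) w && fibre_monotone c w)
      (-1) ^+ w * minor_product c w.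
Proof.
rewrite det_masked.
have /fin_all_exists [std hstd] := exists_standardisation c.
pose Q w := compatible (block_mask c) w && fibre_monotone c w.
have comp_eq (w w' : 'S_n) : (forall i, c (w i) = c (w' i)) ->
    compatible (block_mask c) w = compatible (block_mask c) w'.
  by move=> e; apply: eq_forallb => i; rewrite /block_mask e.
rewrite (partition_big std Q) => [|w' hw']; last first.
  by rewrite /Q (hstd w').2 andbT (comp_eq _ w' (hstd w').1).
apply: eq_bigr => w /andP [hw hm]; rewrite -det_fibres// det_masked.
apply: eq_bigl => w'; apply/andP/forallP => [[_ /eqP <-] i|h].
  by rewrite (hstd w').1.
have e i : c (w i) = c (w' i) by apply/esym/eqP/h.
split; first by rewrite -(comp_eq _ _ e).
apply/eqP; apply: (fibre_monotone_inj (hstd w').2 hm) => i.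
by rewrite (hstd w').1 e.
Qed.

(** * Jellyfish tableaux as compatible fibre-monotone permutations *)

Definition tableau_of (c : 'I_n -> 'I_d) (w : 'S_n) : tableau n d :=
  \matrix_(i < (n - d).+1, j < d)
     [pick x | (c x == j) && (row_of ((w^-1)%g x) == i :> nat)].

(** For compatible [w] the pick in [tableau_of] involves no choice: by [row_of_mono], two letters of
    one block never share a row. *)
Lemma tableau_ofE (c : 'I_n -> 'I_d) (w : 'S_n) i j p :
  compatible (block_mask c) w ->
  (tableau_of c w i j == Some (w p)) = (c (w p) == j) && (row_of p == i :> nat).
Proof.
move=> hw; rewrite mxE; case: pickP => [x|h]; last first.
  by have := h (w p); rewrite permK => ->.
have [q ->] : exists q, x = w q by exists ((w^-1)%g x); rewrite permKV.
rewrite permK => /andP [/eqP ex /eqP ei].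
apply/eqP/andP => [[/perm_inj <-]|[/eqP ep /eqP rp]]; first by rewrite ex ei.
congr (Some (w _)).
have [qp|pq|/val_inj//] := ltngtP q p.
  by have := row_of_mono hw (etrans ex (esym ep)) qp; rewrite ei rp ltnn.
by have := row_of_mono hw (etrans ep (esym ex)) pq; rewrite ei rp ltnn.
Qed.

Lemma tableau_ofP (c : 'I_n -> 'I_d) (w : 'S_n) i j x :
  compatible (block_mask c) w -> tableau_of c w i j = Some x ->
  exists p, [/\ x = w p, c (w p) = j & row_of p = i :> nat].
Proof.
move=> hw /eqP; rewrite -[x](permKV w) tableau_ofE// => /andP [/eqP h1 /eqP h2].
by exists ((w^-1)%g x).
Qed.

Lemma tableau_of_unique (c : 'I_n -> 'I_d) (w : 'S_n) (T : tableau n d) :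
  compatible (block_mask c) w ->
  (forall i j p, (T i j == Some (w p)) = (c (w p) == j) && (row_of p == i :>
    nat)) ->
  T = tableau_of c w.
Proof.
move=> hw hT; apply/matrixP => i j.
case e : (tableau_of c w i j) => [x|].
  by apply/eqP; move: e => /eqP; rewrite -[x](permKV w) tableau_ofE// hT.
case e' : (T i j) => [x|//].
by move: e' => /eqP; rewrite -[x](permKV w) hT -(tableau_ofE i j _ hw) e.
Qed.

(** A cell determines its position in the word: in row 0 it is the column index, and in a row
    [i > 0] it is [d + i - 1]. *)
Lemma tableau_of_inj (c : 'I_n -> 'I_d) :
  {in [pred w | compatible (block_mask c) w] &, injective (tableau_of c)}.
Proof.
move=> w1 w2; rewrite !inE => h1 h2 e; apply/permP => p.
have hr : (row_of p < (n - d).+1)%N.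
  by rewrite val_row_of; have := ltn_ord p; lia.
have := tableau_ofE (Ordinal hr) (c (w1 p)) p h1; rewrite !eqxx /= e => /eqP h.
have [q [eq1 eq2 eq3]] := tableau_ofP h2 h.
rewrite eq1; congr (w2 _); apply: val_inj => /=.
move/compatible_blockP/(_ p): h1; move/compatible_blockP/(_ q): h2.
by move: eq3; rewrite /= !val_row_of eq2; lia.
Qed.

Lemma pmap_single (I : eqType) (T : Type) (f : I -> option T) (s : seq I) k y :
  uniq s -> k \in s -> (forall j, f j = if j == k then Some y else None) ->
  pmap id (map f s) = [:: y].
Proof.
move=> us ks hf.
suff -> : pmap id (map f s) = [seq y | j <- s & j == k].
  by rewrite (filter_pred1_uniq us ks).
elim: s {us ks} => //= j s IH; rewrite hf; case: eqP => //= _.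
by rewrite IH.
Qed.

Lemma reading_word_tableau_of (c : 'I_n -> 'I_d) (w : 'S_n) :
  compatible (block_mask c) w ->
  reading_word (tableau_of c w) = [seq val (w p) | p <- enum 'I_n].
Proof.
move=> hw; rewrite /reading_word.
have hpos (i : 'I_(n - d)) : (d + i < n)%N by have := ltn_ord i; lia.
pose pos (i : 'I_(n - d)) := Ordinal (hpos i).
(* The positions split into the [d] cells of row 0 and one position for each later row. *)
have -> : enum 'I_n = map (widen_ord hdn) (enum 'I_d) ++ map pos (enum 'I_(n -
  d)).
  apply: (inj_map val_inj); rewrite val_enum_ord map_cat -(map_comp val
    (widen_ord hdn)) -(map_comp val pos).
  rewrite -[X in iota 0 X](subnKC hdn) iotaD; congr (_ ++ _).
    by rewrite -val_enum_ord; apply: eq_map.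
  by rewrite add0n -[X in iota X]addn0 iotaDl -(val_enum_ord (n - d)) -map_comp.
rewrite map_cat -(map_comp _ (widen_ord hdn)) -(map_comp _ pos) enum_ordSl /=
  pmap_cat map_cat.
congr (_ ++ _).
  rewrite (_ : map _ _ = map Some (map (w \o widen_ord hdn) (enum 'I_d))).
    by rewrite map_pK// -map_comp.
  rewrite -map_comp; apply: eq_map => j /=; apply/eqP; rewrite tableau_ofE//.
  rewrite val_row_of /=; move/compatible_blockP: hw => /(_ (widen_ord hdn j))
    /=.
  have := ltn_ord j => jd /(_ jd) e; rewrite subn_eq0 jd andbT.
  exact/eqP/val_inj.
(* Row [i + 1] contributes the single letter [w (pos i)]. *)
elim: (enum 'I_(n - d)) => //= i s IH; rewrite pmap_cat map_cat IH -cat1s.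
congr (_ ++ _); rewrite (@pmap_single _ _ _ _ (c (w (pos i))) (w (pos i)))
  ?enum_uniq ?mem_enum//.
move=> j; case: eqP => [->|ne].
  apply/eqP; rewrite tableau_ofE// eqxx /= val_row_of /= /bump /=; lia.
case e : (tableau_of _ _ _ _) => [x|//].
have [p [_ e2 e3]] := tableau_ofP hw e; case: ne; rewrite -e2; congr (c (w _)).
by apply: val_inj; move: e3; rewrite val_row_of /= /bump /=; lia.
Qed.

Lemma inv_tableau_of (c : 'I_n -> 'I_d) (w : 'S_n) (R : pzRingType) :
  compatible (block_mask c) w ->
  (-1) ^+ Defs.inv (tableau_of c w) = (-1) ^+ (w : bool) :> R.
Proof.
move=> hw; rewrite -sign_inversions /Defs.inv reading_word_tableau_of//.
set s := map _ _; have es : size s = n by rewrite size_map size_enum_ord.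
have hs (i : 'I_n) : nth 0%N s i = w i.
  by rewrite (nth_map i) ?size_enum_ord// nth_ord_enum.
suff -> : inversions s = #|[set ab : 'I_n * 'I_n |
    (ab.1 < ab.2)%N && (nth 0%N s ab.2 < nth 0%N s ab.1)%N]|.
  by congr (_ ^+ _); apply: eq_card => -[i j]; rewrite !inE !hs.
(* [size s] equals [n] only propositionally; eliminating the equation identifies the two ordinal
   types. *)
by move: es; case: _ /.
Qed.

Lemma nonempty_rows_tableau_of (c : 'I_n -> 'I_d) (w : 'S_n) j :
  compatible (block_mask c) w ->
  nonempty_rows (tableau_of c w) j = row_of @: [set p | c (w p) == j].
Proof.
move=> hw; apply/setP => k; rewrite inE; apply/existsP/imsetP.
  case=> i /andP [/eqP ik]; case e : (tableau_of _ _ _ _) => [x|//] _.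
  have [p [_ e2 e3]] := tableau_ofP hw e; exists p; first by rewrite inE e2.
  by apply: val_inj; rewrite /= e3 ik.
case=> p; rewrite inE => hp ->.
have hr : (row_of p < (n - d).+1)%N.
  by rewrite val_row_of; have := ltn_ord p; lia.
exists (Ordinal hr); rewrite eqxx /=.
have := tableau_ofE (Ordinal hr) j p hw; rewrite hp eqxx /= => /eqP -> //.
Qed.

Lemma tableau_of_jellyfish (c : 'I_n -> 'I_d) (w : 'S_n) (B : blocks n d) :
  (forall j, B j = [set x | c x == j]) ->
  compatible (block_mask c) w -> fibre_monotone c w ->
  is_jellyfish B (tableau_of c w).
Proof.
move=> hB hw /fibre_monotoneP hm; apply/and4P; split.
- apply/forallP => j.
  have := tableau_ofE ord0 j (widen_ord hdn j) hw.
  rewrite val_row_of /=; move/compatible_blockP: (hw) => /(_ (widen_ord hdn j))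
    /=.
  have jd := ltn_ord j; move=> /(_ jd) /val_inj ->.
  by rewrite eqxx subn_eq0 jd => /eqP ->.
- apply/forallP => i; apply/implyP => i0.
  (* For [i > 0] this is the only position in row [i]. *)
  have hp : (d + i - 1 < n)%N by have := ltn_ord i; lia.
  rewrite (_ : finset _ = [set c (w (Ordinal hp))]) ?cards1//.
  apply/setP => j; rewrite !inE; apply/idP/eqP => [|->].
    case e : (tableau_of _ _ _ _) => [x|//] _.
    have [p [_ <- e3]] := tableau_ofP hw e; congr (c (w _)).
    by apply: val_inj; move: e3; rewrite val_row_of /=; lia.
  have := tableau_ofE i (c (w (Ordinal hp))) (Ordinal hp) hw.
  rewrite eqxx val_row_of /= => h.
  have /eqP -> // : tableau_of c w i (c (w (Ordinal hp))) == Some (w (Ordinal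
    hp)).
  by rewrite h; apply/eqP; lia.
- apply/forallP => j; apply/eqP/setP => x; rewrite hB !inE; apply/existsP/eqP.
    by case=> i /eqP /(tableau_ofP hw) [p [-> ->]].
  move=> cx; pose p := (w^-1)%g x.
  have hr : (row_of p < (n - d).+1)%N.
    by rewrite val_row_of; have := ltn_ord p; lia.
  exists (Ordinal hr); rewrite -[x](permKV w) -/p tableau_ofE//.
  by rewrite permKV cx !eqxx.
apply/forallP => j; do 4!apply/forallP => ?; apply/implyP.
case/and3P => ii /eqP /(tableau_ofP hw) [p [-> ep rp]].
move=> /eqP /(tableau_ofP hw) [q [-> eq rq]].
have epq : c (w p) = c (w q) by rewrite ep eq.
apply: hm => //.
have [//|qp|/val_inj e] := ltngtP p q.
  have := row_of_mono hw (esym epq) qp; rewrite rp rq; lia.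
by move: rp; rewrite e rq; lia.
Qed.

(** The word is read off position by position. It has no repeated letter: a letter determines its
    column by its block, then its row because columns increase strictly, and the cell determines the
    position. *)
Lemma jellyfish_tableau_of (c : 'I_n -> 'I_d) (B : blocks n d) (T : tableau n
  d) :
  (forall j, B j = [set x | c x == j]) -> is_jellyfish B T ->
  exists w : 'S_n, [/\ compatible (block_mask c) w, fibre_monotone c w
                     & T = tableau_of c w].
Proof.
move=> hB /and4P [/forallP h1 /forallP h2 /forallP h3 /forallP h4].
have col i j x : T i j = Some x -> c x = j.
  move=> e; apply/eqP; have /eqP/setP/(_ x) := h3 j; rewrite hB !inE => <-.
  by apply/existsP; exists i; rewrite e.
have incr (i i' : 'I_(n - d).+1) j (x y : 'I_n) : (i < i')%N -> T i j = Some x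
  -> T i' j = Some y -> (x < y)%N.
  move=> ii ex ey; have := h4 j.
  by move/forallP/(_ i)/forallP/(_ i')/forallP/(_ x)/forallP/(_ y)/implyP;
    apply; rewrite ii ex ey !eqxx.
have hpos (p : 'I_n) : exists (x : 'I_n) (i : 'I_(n - d).+1) (j : 'I_d),
    [/\ row_of p = i :> nat, T i j = Some x & (p < d)%N -> j = p :> nat].
  have [pd|dp] := ltnP p d.
    have := h1 (Ordinal pd); case e : (T _ _) => [x|//] _.
    exists x, ord0, (Ordinal pd); split=> //.
    by rewrite val_row_of /=; apply/eqP; rewrite subn_eq0.
  have hr : (row_of p < (n - d).+1)%N.
    by rewrite val_row_of; have := ltn_ord p; lia.
  have r0 : (0 < row_of p)%N by rewrite val_row_of subn_gt0 ltnS.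
  have := h2 (Ordinal hr); rewrite /= r0 /=.
  case/cards1P => j /setP /(_ j); rewrite !inE eqxx.
  by case e : (T _ _) => [x|//] _; exists x, (Ordinal hr), j.
have [f hf] := fin_all_exists hpos.
have f_inj : injective f.
  move=> p q e.
  have [i [j [rp ep cp]]] := hf p; have [i' [j' [rq eq cq]]] := hf q.
  have jj : j = j' by rewrite -(col _ _ _ ep) -(col _ _ _ eq) e.
  have ii : i = i' :> nat.
    case: (ltngtP i i') => // ii.
      by have := incr _ _ _ _ _ ii ep; rewrite jj => /(_ _ eq); rewrite e ltnn.
    by have := incr _ _ _ _ _ ii eq; rewrite -jj => /(_ _ ep); rewrite e ltnn.
  move: rp rq; rewrite !val_row_of; case: (ltnP p d) => [/[dup] pd /cp jp|dp]
    rp rq.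
    by apply: val_inj; rewrite /= -jp jj cq//; lia.
  by apply: val_inj => /=; lia.
pose w : 'S_n := perm f_inj.
have wP p : exists (i : 'I_(n - d).+1) (j : 'I_d), [/\ row_of p = i :> nat, T i
  j = Some (w p), c (w p) = j
                          & (p < d)%N -> j = p :> nat].
  have [i [j [h h' h'']]] := hf p; exists i, j; rewrite permE; split=> //.
  exact: col h'.
have hw : compatible (block_mask c) w.
  by apply/compatible_blockP => p pd; have [i [j [_ _ -> ->]]] := wP p.
exists w; split=> //.
  apply/fibre_monotoneP => p q pq e; have := row_of_mono hw e pq.
  have [i [j [-> ep cp _]]] := wP p; have [i' [j' [-> eq cq _]]] := wP q => ii.
  by apply: (incr _ _ _ _ _ ii ep); rewrite -cp e cq.
apply: tableau_of_unique => // i j p.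
have [i' [j' [ri ep cp _]]] := wP p; apply/eqP/andP => [e|[/eqP e /eqP e']].
  have jj := col _ _ _ e; split; first exact/eqP.
  rewrite ri; apply/eqP; rewrite -cp jj in ep.
  case: (ltngtP i' i) => // ii.
    by have := incr _ _ _ _ _ ii ep e; rewrite ltnn.
  by have := incr _ _ _ _ _ ii e ep; rewrite ltnn.
by rewrite -ep -e cp; congr (T _ _); apply: val_inj; rewrite /= -e' ri.
Qed.

(** Tableaux correspond bijectively to compatible fibre-monotone permutations, with matching signs
    and monomials. *)
Lemma jellyfish_invariantE (c : 'I_n -> 'I_d) (B : blocks n d) :
  (forall j, B j = [set x | c x == j]) ->
  jellyfish_invariant K B = \det (masked hook_mx (block_mask c)).
Proof.
move=> hB; rewrite det_block_mask /jellyfish_invariant.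
pose A := [set w | compatible (block_mask c) w && fibre_monotone c w].
have -> : jellyfish_tableaux B = tableau_of c @: A.
  apply/setP => T; rewrite inE; apply/idP/imsetP.
    case/(jellyfish_tableau_of hB) => w [h1 h2 ->]; exists w => //.
    by rewrite inE h1.
  by case=> w; rewrite inE => /andP [h1 h2] ->; apply: tableau_of_jellyfish.
rewrite big_imset => [|w1 w2]; last first.
  rewrite !inE => /andP [h1 _] /andP [h2 _]; exact: tableau_of_inj.
apply: eq_big => w; first by rewrite inE.
rewrite inE => /andP [h1 h2]; rewrite inv_tableau_of//; congr (_ * _).
by apply: eq_bigr => j _; rewrite nonempty_rows_tableau_of// hB.
Qed.

(** * Hook generators *)

(** The [E_Q] of the overview; indexing by a set forgets the order of the singletons. *)
Definition hook_vector (Q : {set 'I_n}) : {mpoly K[n * n]} :=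
  minor K (first_rows n (n - d + 1)) (~: Q)
  * \prod_(a in Q) minor K (first_rows n 1) [set a].

(** * Partitions with at most one non-singleton block *)

Section UnitRows.
Variables (w0 : 'S_n) (j0 : 'I_d).

Definition unit_mask : rel 'I_n :=
  fun p a => (p < d)%N && (p != j0 :> nat) ==> (a == w0 p).

(** The default [j0] of [insubd] sends the letters at positions from [d] on to block [j0]; every
    other block is a singleton. *)
Definition unit_blocks (a : 'I_n) : 'I_d := insubd j0 (val ((w0^-1)%g a)).

Definition unit_columns : {set 'I_n} :=
  [set w0 (widen_ord hdn j) | j in [set~ j0]].

Lemma unit_blocksE p : val (unit_blocks (w0 p)) = (if (p < d)%N then val p else
  val j0).
Proof. by rewrite /unit_blocks permK val_insubd. Qed.

Lemma unit_blocks_eq (p a : 'I_n) : (p < d)%N -> p != j0 :> nat ->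
  (unit_blocks a == p :> nat) = (a == w0 p).
Proof.
move=> pd pj; rewrite -[a](permKV w0) unit_blocksE (inj_eq perm_inj) -val_eqE
  /=.
by case: ifP => //; lia.
Qed.

(** A permutation that agrees with [w0] on the singleton rows must, by injectivity, map the
    remaining rows to the remaining columns. *)
Lemma compatible_unit_mask (v : 'S_n) :
  compatible unit_mask v
  = compatible (fun p a => unit_blocks a == unit_blocks (w0 p)) v.
Proof.
apply/forallP/forallP => h p.
  apply/eqP/val_inj; rewrite /= unit_blocksE.
  case: (boolP ((p < d)%N && (p != j0 :> nat))) => [pD|pD].
    have := h p; rewrite /unit_mask pD => /eqP ->.
    by rewrite unit_blocksE; case/andP: pD => ->.
  have -> : (if (p < d)%N then val p else val j0) = val j0.
    by move: pD; case: ifP => //=; rewrite negbK => _ /eqP.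
  apply/eqP; apply: contraNT pD => ne; set q := (w0^-1)%g (v p).
  have vq : v p = w0 q by rewrite permKV.
  have qD : (q < d)%N && (q != j0 :> nat).
    by move: ne; rewrite vq unit_blocksE; case: ifP => //; rewrite eqxx.
  have := h q; rewrite /unit_mask qD /= -vq => /eqP /perm_inj.
  by move=> <-.
apply/implyP => /andP [pd pj]; rewrite -unit_blocks_eq//.
by have /eqP -> := h p; rewrite unit_blocksE pd.
Qed.

Lemma compatible_unit_blocks (v : 'S_n) :
  compatible (block_mask unit_blocks) v = compatible unit_mask v.
Proof.
apply/forallP/forallP => h p.
  apply/implyP => /andP [pd pj]; rewrite -unit_blocks_eq//.
  by have /implyP/(_ pd) := h p.
have : compatible unit_mask v by apply/forallP.
rewrite compatible_unit_mask => /forallP/(_ p)/eqP; rewrite /block_mask => ->.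
by apply/implyP => pd; rewrite unit_blocksE pd.
Qed.

Lemma unit_columnsE a : (a \in unit_columns) = (unit_blocks a != j0).
Proof.
apply/imsetP/idP => [[j]|h].
  rewrite !inE => jj ->; rewrite -val_eqE /= unit_blocksE /=.
  by rewrite ltn_ord.
exists (unit_blocks a); first by rewrite !inE.
apply/eqP; rewrite -unit_blocks_eq//=.
Qed.

(** [det_fibres] applies to the standardisation of [w0], whose sign is [e]. Block [j0] occupies rows
    0, ..., n - d, and each singleton occupies row 0. *)
Lemma det_unit_mask :
  exists e : bool,
    \det (masked hook_mx unit_mask) = (-1) ^+ e * hook_vector unit_columns.
Proof.
have [w [hcw hm]] := exists_standardisation unit_blocks w0.
have hw : compatible (block_mask unit_blocks) w.
  by apply/compatible_blockP => p pd; rewrite hcw unit_blocksE pd.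
exists w; transitivity (\det (masked hook_mx
    (fun p a => unit_blocks a == unit_blocks (w p)))).
  rewrite !det_masked; apply: eq_bigl => v; rewrite compatible_unit_mask.
  by apply: eq_forallb => p; rewrite hcw.
rewrite det_fibres//; congr (_ * _); rewrite /minor_product (bigD1 j0)//=.
congr (_ * _).
  congr (minor K _ _); last by apply/setP => a;
    rewrite !inE unit_columnsE negbK.
  apply/setP => k; rewrite inE; apply/imsetP/idP => [[p]|kd].
    rewrite inE -val_eqE /= hcw unit_blocksE => h ->; rewrite val_row_of.
    by have := ltn_ord p; lia.
  (* Within block [j0], row 0 is met at position [j0] and row [k > 0] at position [d + k - 1]. *)
  have hp : ((if k == 0 :> nat then j0 : nat else d + k - 1) < n)%N.
    by have := ltn_ord j0; case: eqP; lia.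
  exists (Ordinal hp).
    rewrite inE -val_eqE /= hcw unit_blocksE /=.
    by have := ltn_ord j0; case: (eqVneq (k : nat) 0%N); case: ifP => //; lia.
  apply: val_inj; rewrite /= val_row_of /=.
  by have := ltn_ord j0; case: eqP; lia.
rewrite /unit_columns big_imset /= => [|i j _ _ /perm_inj /(congr1 val) /=
  /val_inj //].
apply: eq_big => [j|j jj]; first by rewrite !inE.
congr (minor K _ _).
  apply/setP => k; rewrite inE; apply/imsetP/idP => [[p]|k1].
    rewrite inE -val_eqE /= hcw unit_blocksE => h ->; rewrite val_row_of.
    by move: h jj; rewrite -val_eqE /=; have := ltn_ord j; case: ifP; lia.
  exists (widen_ord hdn j).
    by rewrite inE -val_eqE /= hcw unit_blocksE /= ltn_ord.
  by apply: val_inj; rewrite /= val_row_of /=; have := ltn_ord j; lia.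
apply/setP => a; rewrite !inE -unit_blocks_eq//=.
Qed.

End UnitRows.

(** A permutation carrying the positions 1, ..., d - 1 onto [Q] makes the elements of [Q] singletons
    and puts the rest in block 0. *)
Lemma hook_vector_unit (Q : {set 'I_n}) : #|Q| = (d - 1)%N ->
  exists (c : 'I_n -> 'I_d) (e : bool),
    hook_vector Q = (-1) ^+ e * \det (masked hook_mx (block_mask c)).
Proof.
move=> cQ; pose j0 : 'I_d := Ordinal hd.
pose D := [set widen_ord hdn j | j in [set~ j0]].
have cD : #|D| = (d - 1)%N.
  rewrite card_imset => [|i j /(congr1 val) /= /val_inj //].
  by rewrite cardsC1 card_ord subn1.
have [w hw] := exists_perm_mem (etrans cD (esym cQ)).
have -> : Q = unit_columns w j0.
  apply/setP => a; rewrite -[a](permKV w) hw /unit_columns.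
  rewrite (_ : [set _ | _ in _] = w @: D); first by rewrite (mem_imset _ _
    (@perm_inj _ w)).
  by rewrite -imset_comp.
exists (unit_blocks w j0).
have [e he] := det_unit_mask w j0; exists e.
rewrite det_masked (eq_bigl _ _ (compatible_unit_blocks w j0)) -det_masked he.
by rewrite mulrA -signr_addb addbb mul1r.
Qed.

(** * Comparison with the hook Specht module *)

Definition ord_zero : 'I_n := Ordinal (leq_trans hd hdn).

(* Let j0 be the block containing 0. Adding the rows of the other blocks to
   row j0 makes that row entire, and the other rows avoid column 0. *)
Lemma det_block_mask_span (c : 'I_n -> 'I_d) :
  family_span (hook_subsets n d) hook_vector
    (\det (masked hook_mx (block_mask c))).
Proof.
pose j0 := c ord_zero.
pose m1 : rel 'I_n :=
  fun p a => (p < d)%N && (p != j0 :> nat) ==> (c a == p :> nat).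
have -> : \det (masked hook_mx (block_mask c)) = \det (masked hook_mx m1).
  apply/esym/(det_add_rows (i0 := widen_ord hdn j0)
    (D := [pred p : 'I_n | (p < d)%N && (p != j0 :> nat)])).
  - by rewrite inE /= eqxx andbF.
  - move=> i j; rewrite -val_eqE /= => ne.
    by rewrite !mxE /m1 /block_mask ne andbT.
  move=> a; rewrite [LHS]mxE /m1 /= eqxx andbF /= [X in _ = X + _]mxE.
  rewrite {1}/block_mask /= ltn_ord /=.
  have X0 (p : 'I_n) : (p < d)%N -> hook_mx p a = hook_mx (widen_ord hdn j0) a.
    move=> pd; rewrite !mxE; congr ('X_(mxvec_index _ _)); apply: val_inj.
    by rewrite /= !val_row_of /=; have := ltn_ord j0; lia.
  have [ca|ca] := eqVneq (c a : nat) j0.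
    rewrite big1 ?addr0// => p /andP [pd pj]; rewrite mxE /block_mask pd /= ca.
    by rewrite eq_sym (negPf pj).
  rewrite add0r (bigD1 (widen_ord hdn (c a))) /=;
    last by rewrite inE /= ltn_ord.
  rewrite [X in X + _]mxE /block_mask /= eqxx implybT.
  rewrite (X0 (widen_ord hdn (c a)))/= ?ltn_ord//.
  rewrite big1 ?addr0// => p /andP [/andP [pd pj]]; rewrite -val_eqE /= => ne.
  by rewrite mxE /block_mask pd /= eq_sym (negPf ne).
rewrite det_masked.
(* The key records the columns hit by the rows below [d] other than [j0], with a dummy value at
   [j0]. For a fixed key the Leibniz sum is empty or a determinant with unit rows. *)
pose key (v : 'S_n) : {ffun 'I_d -> 'I_n} :=
  [ffun j => if j == j0 then ord_zero else v (widen_ord hdn j)].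
rewrite (partition_big key predT)//; apply: family_span_sum => h _.
case: (pickP (fun v : 'S_n => compatible m1 v && (key v == h)))
  => [w0 /andP [/forallP cw /eqP kw]|none]; last first.
  by rewrite big_pred0//; apply: family_span0.
have -> : \sum_(v | compatible m1 v && (key v == h)) leibniz_term hook_mx v
          = \det (masked hook_mx (unit_mask w0 j0)).
  rewrite det_masked; apply: eq_bigl => v; apply/andP/forallP => [[_ /eqP kv]
    p|hv].
    apply/implyP => /andP [pd pj]; move: kv; rewrite -kw => /ffunP /(_ (Ordinal
      pd)).
    rewrite !ffunE -val_eqE /= (negPf pj).
    by rewrite (_ : widen_ord _ _ = p) => [->|]//; apply: val_inj.
  have hv' (p : 'I_n) : (p < d)%N && (p != j0 :> nat) -> v p = w0 p.
    by move=> pD; apply/eqP; have /implyP := hv p; apply.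
  split; first by apply/forallP => p; apply/implyP => pD;
    rewrite hv'//; move: (cw p); rewrite /m1 pD.
  rewrite -kw; apply/eqP/ffunP => j; rewrite !ffunE; case: eqP => // /eqP jj.
  by apply: hv'; rewrite /= ltn_ord.
have [e ->] := det_unit_mask w0 j0.
rewrite mulr_sign -(scaler_sign (R := K)).
apply/family_spanZ/family_span_mem; rewrite inE; apply/andP; split.
  apply/subsetP => a /imsetP [j]; rewrite !inE => jj ->.
  rewrite -val_eqE /= in jj; rewrite lt0n; apply/eqP => a0.
  have := cw (widen_ord hdn j); rewrite /m1 /= ltn_ord jj /=.
  have -> : w0 (widen_ord hdn j) = ord_zero by apply: val_inj.
  by rewrite -/j0 eq_sym (negPf jj).
rewrite card_imset => [|i j /perm_inj /(congr1 val) /= /val_inj //].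
by rewrite cardsC1 card_ord subn1.
Qed.

(** A generator with [ord_zero] among its singletons is not one of the spanning vectors on the
    right, but up to sign it is a block determinant, so [det_block_mask_span] expands it. *)
Lemma hook_spechtE x :
  @hook_specht K n d x <-> family_span (hook_subsets n d) hook_vector x.
Proof.
split; apply: family_span_trans => s; rewrite inE.
  case/and4P => /eqP c1 /forallP h2 /forallP h3 /eqP h4.
  have s2_inj : injective s.2.
    move=> i i' e; apply/eqP; have /forallP/(_ i') := h3 i.
    by rewrite e eqxx implybF negbK.
  have im : s.2 @: setT = ~: s.1.
    apply/setP => a; rewrite inE; apply/imsetP/idP => [[i _ ->]//|ha].
    have : a \in s.1 :|: [set s.2 i | i : 'I_(d - 1)] by rewrite h4 inE.
    by rewrite inE (negPf ha) /= => /imsetP [i _ ->]; exists i.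
  have -> : hook_generator K s = hook_vector (~: s.1).
    rewrite /hook_generator /hook_vector setCK -im; congr (_ * _).
    by rewrite big_imset /= => [|i j _ _ /s2_inj//]; apply: eq_bigl => i;
      rewrite inE.
  have [|c [e ->]] := @hook_vector_unit (~: s.1).
    by have := cardsC s.1; rewrite card_ord c1; lia.
  rewrite mulr_sign -(scaler_sign (R := K)).
  exact/family_spanZ/det_block_mask_span.
move: s => Q /andP [_ /eqP cQ].
pose f : {ffun 'I_(d - 1) -> 'I_n} := [ffun i : 'I_(d - 1) => nth ord_zero
  (enum Q) i].
have szQ : size (enum Q) = (d - 1)%N by rewrite -cardE.
have fQ i : f i \in Q by rewrite ffunE -mem_enum mem_nth// szQ.
have f_inj : injective f.
  move=> i j; rewrite !ffunE => /eqP; rewrite nth_uniq ?enum_uniq ?szQ//.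
  by move/eqP/val_inj.
have im : f @: setT = Q.
  apply/eqP; rewrite eqEcard card_imset// cardsT card_ord cQ leqnn andbT.
  by apply/subsetP => a /imsetP [i _ ->].
have -> : hook_vector Q = hook_generator K (~: Q, f).
  rewrite /hook_generator /hook_vector /=; congr (_ * _).
  rewrite -{1}im big_imset /= => [|i j _ _ /f_inj//].
  by apply: eq_bigl => i; rewrite inE.
apply: family_span_mem; rewrite inE /=; apply/and4P; split.
- by rewrite cardsCs setCK card_ord cQ; apply/eqP; lia.
- by apply/forallP => i; rewrite inE negbK.
- by apply/forallP => i; apply/forallP => j; rewrite (inj_eq f_inj) implybb.
apply/eqP/setP => a; rewrite !inE; case: (boolP (a \in Q)) => //=.
by rewrite -{1}im => /imsetP [i _ ->]; rewrite imset_f.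
Qed.

(** * Evaluations and triangularity *)

(* The matrix evaluated here has as row 0 the indicator of A and as other rows
   the unit vectors of the elements outside A; on it only the partitions for
   which A is transversal survive. *)
Lemma exists_evaluation (A : {set 'I_n}) : #|A| = d ->
  exists v : 'I_(n * n) -> K, forall c : 'I_n -> 'I_d,
    ((\det (masked hook_mx (block_mask c))).@[v] != 0) = (c @: A == setT).
Proof.
move=> cA.
pose D := [set widen_ord hdn j | j : 'I_d].
have memD p : (p \in D) = (p < d)%N.
  apply/imsetP/idP => [[j _ ->]|pd]; first exact: (ltn_ord j).
  by exists (Ordinal pd) => //; apply: val_inj.
have cD : #|D| = d.
  by rewrite card_imset ?cardsT ?card_ord// => i j /(congr1 val) /= /val_inj.
(* [w] lists [A] at the positions below [d] and its complement at the others, which fixes the unit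
   vector standing in each row. *)
have [w hw] := exists_perm_mem (etrans cD (esym cA)).
pose V : 'M[K]_n := \matrix_(i, a) (if i == 0 :> nat then a \in A
  else [exists p, (row_of p == i) && (w p == a)])%:R.
exists (mxvec V 0) => c; rewrite -det_map_mx; set N := map_mx _ _.
have NE p a : N p a = (if (p < d)%N then (c a == p :> nat) && (a \in A)
                       else w p == a)%:R.
  rewrite !mxE /block_mask; case: (ltnP p d) => pd /=.
    case: (c a == p :> nat); rewrite /= ?rmorph0//.
    by rewrite mevalXU mxvecE mxE val_row_of subn_eq0 pd.
  rewrite mevalXU mxvecE mxE val_row_of subn_eq0 ltnNge pd /=;
    congr (nat_of_bool _)%:R.
  apply/existsP/eqP => [[q /andP [/eqP/(congr1 val) /= e /eqP <-]]|e];
    last first.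
    by exists p; rewrite e !eqxx.
  congr (w _); apply: val_inj; move: e; rewrite !val_row_of /=; lia.
apply/idP/eqP => [|cT].
  (* A block [j] that misses [A] makes row [j] of [N] zero. *)
  apply: contraNeq; rewrite -subTset => /subsetPn [j _ hj].
  rewrite (expand_det_row _ (widen_ord hdn j)) big1// => a _.
  rewrite NE /= ltn_ord; case: andP => [[/eqP/val_inj ca aA]|];
    last by rewrite mul0r.
  by rewrite -ca imset_f in hj.
have /fin_all_exists [t ht] : forall j, exists a, (a \in A) /\ c a = j.
  move=> j; have : j \in c @: A by rewrite cT inE.
  by case/imsetP => a; exists a.
have t_inj : injective t by move=> i j e; rewrite -(ht i).2 -(ht j).2 e.
have tA : t @: setT = A.
  apply/eqP; rewrite eqEcard card_imset// cardsT card_ord cA leqnn andbT.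
  by apply/subsetP => a /imsetP [j _ ->]; have [] := ht j.
(* [A] has [d] elements, hence meets each block once. So row [p] of [N] has a single 1, at [t p] for
   [p < d] and at [w p] otherwise. *)
pose f (p : 'I_n) := oapp t (w p) (insub (p : nat)).
have f_lt (j : 'I_d) (p : 'I_n) : p = j :> nat -> f p = t j.
  by move=> e; rewrite /f e valK.
have f_ge (p : 'I_n) : (d <= p)%N -> f p = w p.
  by move=> dp; rewrite /f insubN// -leqNgt.
have fA p : (f p \in A) = (p < d)%N.
  have [pd|dp] := ltnP p d; first by rewrite (f_lt (Ordinal pd))// (ht _).1.
  by rewrite f_ge// hw memD ltnNge dp.
have f_inj : injective f.
  move=> p q e; have := fA p; rewrite e fA => /esym.
  have [pd|dp] := ltnP p d; have [qd|dq] := ltnP q d => // _.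
    move: e; rewrite (f_lt (Ordinal pd))// (f_lt (Ordinal qd))//.
    by move=> /t_inj [] /val_inj.
  by move: e; rewrite !f_ge// => /perm_inj.
have -> : N = perm_mx (perm f_inj).
  apply/matrixP => p a; rewrite NE !mxE permE; congr (nat_of_bool _)%:R.
  have [pd|dp] := ltnP p d; last by rewrite f_ge.
  rewrite (f_lt (Ordinal pd))//; apply/andP/eqP => [[/eqP ca]|<-].
    rewrite -tA => /imsetP [k _ ak]; rewrite ak; congr t; apply: val_inj => /=.
    by rewrite -ca ak (ht k).2.
  by rewrite (ht _).1 (ht _).2 /=.
by rewrite det_perm signr_eq0.
Qed.

(** The rank for triangularity. *)
Definition weight (P : {set 'I_n}) : nat := \sum_(x in P) x.

Lemma card_zero_hook_subset (P : {set 'I_n}) : P \in hook_subsets n d ->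
  (ord_zero \notin P) /\ #|ord_zero |: P| = d.
Proof.
rewrite inE => /andP [/subsetP hP /eqP cP].
have P0 : ord_zero \notin P by apply/negP => /hP; rewrite inE.
by split=> //; rewrite cardsU1 P0 cP add1n subn1 prednK.
Qed.

(** * Block minima and transversals *)

Section Minima.
Variables (c : 'I_n -> 'I_d) (P : {set 'I_n}).
Hypotheses (hP : P \in hook_subsets n d) (c_surj : forall j, exists x, c x = j).
Hypothesis hmin : forall j x, is_smallest x [set a | c a == j] ->
  (x : nat) = 0%N \/ x \in P.

(** The [d] minima are distinct and lie in [ord_zero |: P], a set of [d] elements, which they
    therefore fill. *)
Lemma exists_minima : exists m : 'I_d -> 'I_n,
  [/\ forall j, c (m j) = j, forall x, (m (c x) <= x)%N
    & m @: setT = ord_zero |: P].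
Proof.
have /fin_all_exists [m hm] : forall j, exists x, is_smallest x [set a | c a ==
  j].
  move=> j; have [x0 hx0] := c_surj j.
  have x0P : [pred a | c a == j] x0 by apply/eqP.
  case: (arg_minnP (fun x : 'I_n => x : nat) x0P) => x /eqP cx hx.
  exists x; split; first by rewrite inE cx.
  by move=> y; rewrite inE => /hx.
have cm j : c (m j) = j by have [] := hm j; rewrite inE => /eqP.
exists m; split=> // [x|]; first by apply: (hm (c x)).2; rewrite inE.
have m_inj : injective m by move=> i j e; rewrite -(cm i) -(cm j) e.
apply/eqP; rewrite eqEcard card_imset// cardsT card_ord.
rewrite (card_zero_hook_subset hP).2 leqnn andbT.
apply/subsetP => x /imsetP [j _ ->]; rewrite !inE.
by have [/eqP e|->] := hmin (hm j); rewrite -?val_eqE ?e ?orbT.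
Qed.

Lemma minima_transversal : c @: (ord_zero |: P) = setT.
Proof.
have [m [cm _ <-]] := exists_minima.
by apply/setP => j; rewrite inE -imset_comp; apply/imsetP; exists j;
  rewrite /= ?cm.
Qed.

(* A transversal dominates the minima block by block. *)
Lemma transversal_weight (Q : {set 'I_n}) : Q \in hook_subsets n d ->
  c @: (ord_zero |: Q) = setT -> Q = P \/ (weight P < weight Q)%N.
Proof.
move=> hQ cT; have [m [cm m_le mP]] := exists_minima.
have [P0 cP] := card_zero_hook_subset hP; have [Q0 cQ] := card_zero_hook_subset
  hQ.
have /fin_all_exists [t ht] :
    forall j, exists a, (a \in ord_zero |: Q) /\ c a = j.
  move=> j; have : j \in c @: (ord_zero |: Q) by rewrite cT inE.
  by case/imsetP => a; exists a.
have t_inj : injective t by move=> i j e; rewrite -(ht i).2 -(ht j).2 e.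
have m_inj : injective m by move=> i j e; rewrite -(cm i) -(cm j) e.
have tQ : t @: setT = ord_zero |: Q.
  apply/eqP; rewrite eqEcard card_imset// cardsT card_ord cQ leqnn andbT.
  by apply/subsetP => a /imsetP [j _ ->]; have [] := ht j.
have wE (R : {set 'I_n}) (u : 'I_d -> 'I_n) : ord_zero \notin R -> injective u
  ->
    u @: setT = ord_zero |: R -> weight R = (\sum_j u j)%N.
  move=> R0 u_inj uR; transitivity (\sum_(x in ord_zero |: R) x)%N.
    (* [ord_zero] has value 0 and adds nothing to the weight. *)
    by rewrite (big_setU1 ord_zero).
  by rewrite -uR big_imset /= => [|i j _ _ /u_inj//]; apply: eq_bigl => j;
    rewrite inE.
rewrite (wE P m)// (wE Q t)//.
have mt j : (m j <= t j)%N by rewrite -{1}(ht j).2.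
case: (boolP [forall j, m j == t j]) => [/forallP e|].
  left; have PQ : ord_zero |: P = ord_zero |: Q.
    by rewrite -mP -tQ; apply: eq_imset => j; apply/eqP/e.
  by rewrite -(setU1K P0) PQ setU1K.
rewrite negb_forall => /existsP [j ne]; right.
rewrite (bigD1 j)//= [X in (_ < X)%N](bigD1 j)//= -addSn leq_add//.
  by rewrite ltn_neqAle mt andbT.
by apply: leq_sum => i _; apply: mt.
Qed.

End Minima.

End Hook.

(** * The basis theorem over an arbitrary field *)

Lemma jellyfish_basis (K : fieldType) (n d : nat)
    (hd : (1 <= d)%N) (hdn : (d <= n)%N)
    (pi : {set 'I_n} -> blocks n d)
    (hpi : forall P : {set 'I_n}, P \in hook_subsets n d ->
       NCOP1 (pi P) /\ minima_in_1U P (pi P)) :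
  let H : {set blocks n d} := [set pi P | P in hook_subsets n d] in
  family_basis H (@jellyfish_invariant K n d) (@hook_specht K n d).
Proof.
move=> H.
pose u P := @jellyfish_invariant K n d (pi P).
(* A partition becomes its block-index function: covering gives existence of the index, disjointness
   its uniqueness, nonemptiness surjectivity. *)
have block P : P \in hook_subsets n d -> exists c : 'I_n -> 'I_d,
    (forall j, pi P j = [set x | c x == j]) /\ (forall j, exists x, c x = j).
  move=> /hpi [[[ne disj /setP cover] _] _].
  have /fin_all_exists [c hc] : forall x, exists j, x \in pi P j.
    by move=> x; have := cover x; rewrite inE => /bigcupP [j _ xj]; exists j.
  have cE x j : x \in pi P j -> c x = j.
    move=> xj; apply/eqP; apply: contraT => /disj /disjoint_setI0 /setP /(_ x).
    by rewrite !inE hc xj.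
  exists c; split=> j.
    apply/setP => x; rewrite inE; apply/idP/eqP => [/cE //|<-]; exact: hc.
  by have /set0Pn [x /cE] := ne j; exists x.
have /fin_all_exists [v hv] : forall Q : {set 'I_n},
    exists v : 'I_(n * n) -> K, Q \in hook_subsets n d ->
    forall c : 'I_n -> 'I_d,
      ((\det (masked (hook_mx K n d) (block_mask c))).@[v] != 0)
      = (c @: (ord_zero hd hdn |: Q) == setT).
  move=> Q; case: (boolP (Q \in hook_subsets n d)) => [hQ|_];
    last by exists (fun=> 0).
  have [v hv] := exists_evaluation K hd hdn (card_zero_hook_subset hd hdn hQ).2.
  by exists v.
have u_diag P : P \in hook_subsets n d -> (u P).@[v P] != 0.
  move=> hP; have [c [cB c_surj]] := block P hP; have [_ hmin] := hpi P hP.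
  rewrite /u (jellyfish_invariantE _ hd hdn cB) hv//; apply/eqP.
  apply: minima_transversal => // j x; rewrite -cB; exact: hmin.
have u_triangular Q P : Q \in hook_subsets n d -> P \in hook_subsets n d ->
    (u P).@[v Q] != 0 -> Q = P \/ (weight P < weight Q)%N.
  move=> hQ hP; have [c [cB c_surj]] := block P hP; have [_ hmin] := hpi P hP.
  rewrite /u (jellyfish_invariantE _ hd hdn cB) hv// => /eqP.
  apply: transversal_weight => // j x; rewrite -cB; exact: hmin.
have u_span P : P \in hook_subsets n d ->
    family_span (hook_subsets n d) (@hook_vector K n d) (u P).
  move=> hP; have [c [cB _]] := block P hP.
  by rewrite /u (jellyfish_invariantE _ hd hdn cB); apply: det_block_mask_span.
have u_free : family_free (hook_subsets n d) u.
  exact: (family_free_triangular (rank := @weight n) (phi := fun Q => meval (v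
    Q))).
(* If distinct [P] and [Q] gave the same partition, triangularity in both directions would make each
   weight smaller than the other. *)
apply: family_basis_imset => [P Q hP hQ e|].
  have uPQ : u P = u Q by rewrite /u e.
  have [//|PQ] : P = Q \/ (weight Q < weight P)%N.
    by apply: u_triangular => //; rewrite -uPQ u_diag.
  have [//|] : Q = P \/ (weight P < weight Q)%N.
    by apply: u_triangular => //; rewrite uPQ u_diag.
  by rewrite ltnNge ltnW.
split=> // x; split=> [/(hook_spechtE hd hdn)|].
  (* The invariants are free, lie in the span of the [hook_vector] family and share its index set,
     so they span it. *)
  by apply: family_span_trans; apply: family_free_span.
by move=> h; apply/(hook_spechtE hd hdn); apply: family_span_trans h.
Qed.

Theorem theorem5p11 (R : realType) (n d : nat)
    (hd : (1 <= d)%N) (hdn : (d <= n)%N)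
    (pi : {set 'I_n} -> blocks n d)
    (hpi : forall P : {set 'I_n}, P \in hook_subsets n d ->
       NCOP1 (pi P) /\ minima_in_1U P (pi P)) :
  let H : {set blocks n d} := [set pi P | P in hook_subsets n d] in
  family_basis H (@jellyfish_invariant R[i] n d) (@hook_specht R[i] n d).
Proof. exact: (@jellyfish_basis R[i]). Qed.
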